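(* Let $\lambda>0$ be a positive integer and let $k\leq n$ be positive integers. Suppose that $n\geq \binom{k^2}{\lambda+1}+\lambda$. Let $\mathcal{F}=\{F_1,\ldots,F_m\}$ be a $k$-uniform family of $m$ subsets of $[n]$ such that $|F_i\cap F_j|=\lambda$ for each $1\leq i,j\leq m$, $i\neq j$. Then $$ m\leq n-\lambda. $$ Further, if $n>\binom{k^2}{\lambda+1}+\lambda$ and $$ |\mathcal{F}|=n-\lambda, $$ then there exists a subset $T\subseteq[n]$ with $|T|=\lambda$ such that $T\subseteq F$ for each $F\in\mathcal{F}$.
   Context: $[n]=\{1,2,\ldots,n\}$. A family $\mathcal{F}$ is a set of (distinct) subsets of $[n]$, so $m=|\mathcal{F}|$. A family $\mathcal{F}$ is $k$-uniform if $|F|=k$ for each $F\in\mathcal{F}$.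
   Formalization: The hypothesis λ < k² is added: without it the binomial coefficient is 0 and the claim fails for one-member families (k = λ = n = 1, F = {{1}} gives m = 1 > n − λ = 0); it is automatic as soon as F has two members. *)

(* Defs.v *)
From mathcomp Require Import all_boot.

Set Implicit Arguments.
Unset Strict Implicit.
Unset Printing Implicit Defensive.

(* The ground set [n] = {1, ..., n} is rendered as 'I_n = {0, ..., n-1}. *)

Definition k_uniform (n k : nat) (F : {set {set 'I_n}}) : Prop :=
  forall A : {set 'I_n}, A \in F -> #|A| = k.

Definition pairwise_meet_in (n lambda : nat) (F : {set {set 'I_n}}) : Prop :=
  forall A B : {set 'I_n}, A \in F -> B \in F -> A != B ->
    #|A :&: B| = lambda.

(* Main.v *)
Require Import Defs.
From mathcomp Require Import all_boot.

Set Implicit Arguments.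
Unset Strict Implicit.
Unset Printing Implicit Defensive.

(** A family with at most one member satisfies both claims because the
binomial coefficient is positive.  With two distinct members [lambda < k], and
the proof rests on a dichotomy.

If some [lambda]-set [T] lies in every member, the sets [A :\: T] are nonempty
and pairwise disjoint subsets of the complement of [T], so there are at most
[n - lambda] of them ([card_star_hitting] with [X] the whole ground set).

If there is no such [T], then no [lambda]-set [T] lies in more than [k]
members: a member missing part of [T] would have to meet each of the
disjoint sets [B :\: T], and it has only [k] points ([star_gt_sunflower]).
A fixed member [A] meets every other member in one of its 'C(k, lambda) subsets
of size [lambda], each of which accounts for at most [k.-1] other members
([card_no_sunflower]).  The resulting bound [1 + 'C(k, lambda) * k.-1] does not
exceed 'C(k ^ 2, lambda + 1) ([bin_square_lower_bound]), so the family has at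
most [n - lambda] members, and fewer when [n] is larger than assumed. *)

Definition star (n : nat) (F : {set {set 'I_n}}) (T : {set 'I_n}) :=
  [set A in F | T \subset A].

(** Members of a star pairwise share nothing outside [T], so choosing in each
of them a point of [X] outside [T] is injective. *)
Lemma card_star_hitting (n : nat) (F : {set {set 'I_n}}) (T X : {set 'I_n}) :
  pairwise_meet_in #|T| F ->
  (forall B, B \in star F T -> (B :&: X) :\: T != set0) ->
  #|star F T| <= #|X :\: T|.
Proof.
move=> F_meet hit.
pose f (B : {set 'I_n}) := [pick x in (B :&: X) :\: T].
have fP B : B \in star F T -> exists2 x, x \in (B :&: X) :\: T & f B = Some x.
  move=> /hit/set0Pn[y yB]; rewrite /f.
  by case: pickP => [x xB | /(_ y)]; [exists x | rewrite yB].
have f_inj : {in star F T &, injective f}.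
  move=> B C SB SC; have [x xB ->] := fP B SB; have [y yC ->] := fP C SC.
  case=> eq_xy; rewrite -{y}eq_xy in yC.
  apply/eqP/negPn/negP => neqBC.
  move: SB SC; rewrite !inE => /andP[FB TB] /andP[FC TC].
  move: xB yC; rewrite !inE => /and3P[xT xB _] /and3P[_ xC _].
  have : x |: T \subset B :&: C.
    by rewrite subUset sub1set !inE xB xC subsetI TB TC.
  by move/subset_leq_card; rewrite cardsU1 xT (F_meet B C) // ltnn.
rewrite -(card_in_imset f_inj) -(card_imset (mem (X :\: T)) (@Some_inj _)).
apply/subset_leq_card/subsetP => _ /imsetP[B SB ->].
have [x + ->] := fP B SB; rewrite !inE => /and3P[xT _ xX].
by apply: imset_f; rewrite inE xT.
Qed.

(** A member [A] not containing [T] still shares [#|T|] points with each member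
of the star, hence at least one outside [T]; the star is then no larger than
[A]. *)
Lemma star_gt_sunflower (n k : nat) (F : {set {set 'I_n}}) (T A : {set 'I_n}) :
  k_uniform k F -> pairwise_meet_in #|T| F -> k < #|star F T| ->
  A \in F -> T \subset A.
Proof.
move=> F_uniform F_meet; rewrite ltnNge => /negP big_star FA.
apply/negPn/negP => nTA; apply: big_star.
rewrite -(F_uniform A FA).
apply: leq_trans (subset_leq_card (subsetDl A T)).
apply: card_star_hitting => // B; rewrite inE => /andP[FB TB].
apply: contra (nTA); rewrite setD_eq0 => sBAT.
have neqBA : B != A by apply: contraNneq (nTA) => <-.
have /eqP <- : B :&: A == T by rewrite eqEcard sBAT (F_meet B A) /=.
exact: subsetIr.
Qed.

(** Sort the members other than [A] by their intersection with [A]. *)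
Lemma card_no_sunflower (n k lambda : nat) (F : {set {set 'I_n}})
    (A : {set 'I_n}) :
  k_uniform k F -> pairwise_meet_in lambda F -> A \in F ->
  (forall T : {set 'I_n}, #|T| = lambda -> #|star F T| <= k) ->
  #|F| <= 1 + 'C(k, lambda) * k.-1.
Proof.
move=> F_uniform F_meet FA small_star.
rewrite (cardsD1 A) FA leq_add2l -sum1_card.
pose D := [set T : {set 'I_n} | T \subset A & #|T| == lambda].
rewrite (partition_big (fun B => A :&: B) (mem D)) /=; last first.
  move=> B; rewrite !inE subsetIl => /andP[neqBA FB] /=.
  by rewrite F_meet // eq_sym.
rewrite -(F_uniform A FA) -cards_draws -sum_nat_const (F_uniform A FA).
apply: leq_sum => T; rewrite inE => /andP[TA /eqP cardT].
(* [A] itself belongs to the star of [T], which saves one. *)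
have starA : A \in star F T by rewrite inE FA.
have := small_star T cardT; rewrite (cardsD1 A) starA => le_k.
apply: (@leq_trans #|star F T :\ A|); last by case: (k) le_k.
rewrite sum1_card; apply/subset_leq_card/subsetP => B.
case/andP=> /setD1P[neqBA FB] /eqP <-.
by rewrite !inE neqBA FB subsetIr.
Qed.

(** In a [k] by [k] grid, the sets made of [lambda] points of the first row and
one point of another row already number 'C(k, lambda) * (k * k.-1). *)
Lemma bin_square_lower_bound (k lambda : nat) :
  0 < lambda < k -> 1 + 'C(k, lambda) * k.-1 <= 'C(k ^ 2, lambda.+1).
Proof.
case/andP=> lambda_gt0 lt_lk.
have k_gt1 : 1 < k by apply: leq_ltn_trans lt_lk.
have -> : k ^ 2 = k + k * k.-1.
  by rewrite -mulnS prednK ?mulnn // ltnW.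
rewrite -Vandermonde.
have lt_l : lambda < lambda.+2 by rewrite ltnS.
rewrite (bigD1 (Ordinal lt_l)) //= subSnn bin1.
apply: leq_trans (leq_addr _ _).
have C_gt0 : 0 < 'C(k, lambda) by rewrite bin_gt0 ltnW.
have k1_gt0 : 0 < k.-1 by rewrite -subn1 subn_gt0.
rewrite mulnCA.
by rewrite add1n ltn_Pmull // muln_gt0 C_gt0.
Qed.

Lemma meet_lt_uniform (n k lambda : nat) (F : {set {set 'I_n}}) :
  k_uniform k F -> pairwise_meet_in lambda F -> 1 < #|F| -> lambda < k.
Proof.
move=> F_uniform F_meet /card_gt1P[A [B [FA FB neqAB]]].
rewrite -(F_meet A B) // -(F_uniform A FA); apply: proper_card.
rewrite properE subsetIl subsetI subxx /=.
by apply: contra neqAB => sAB; rewrite eqEcard sAB !F_uniform /=.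
Qed.

(* The hypothesis [lambda < k ^ 2] says that 'C(k ^ 2, lambda.+1) is nonzero.
   It is automatic when F has two members (then lambda < k); without it the
   claim fails for families with one member: with k = lambda = n = 1 the first
   bound would read 1 <= 0, and with k = 1, lambda = 2, n = 3 the set T would
   have two elements and lie inside a singleton. *)
Theorem corollary1p13 (lambda k n : nat)
    (lambda_gt0 : 0 < lambda) (k_gt0 : 0 < k) (le_kn : k <= n)
    (lt_lambda_k2 : lambda < k ^ 2)
    (le_n : 'C(k ^ 2, lambda.+1) + lambda <= n)
    (F : {set {set 'I_n}})
    (F_uniform : k_uniform k F)
    (F_meet : pairwise_meet_in lambda F) :
  #|F| <= n - lambda /\
  ('C(k ^ 2, lambda.+1) + lambda < n -> #|F| = n - lambda ->
   exists T : {set 'I_n},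
     #|T| = lambda /\ (forall A : {set 'I_n}, A \in F -> T \subset A)).
Proof.
have bin_pos : 0 < 'C(k ^ 2, lambda.+1) by rewrite bin_gt0.
have le_bin : 'C(k ^ 2, lambda.+1) <= n - lambda.
  by rewrite leq_subRL ?(leq_trans (leq_addl _ _) le_n) // addnC.
have small : #|F| <= 'C(k ^ 2, lambda.+1) ->
    #|F| <= n - lambda /\
    ('C(k ^ 2, lambda.+1) + lambda < n -> #|F| = n - lambda ->
     exists T : {set 'I_n},
       #|T| = lambda /\ (forall A : {set 'I_n}, A \in F -> T \subset A)).
  move=> le_F; split=> [|lt_n eq_F]; first exact: leq_trans le_bin.
  by move: lt_n; rewrite addnC -ltn_subRL ltnNge -eq_F le_F.
have [le_F1 | F_gt1] := leqP #|F| 1; first exact/small/(leq_trans le_F1).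
have lt_lk := meet_lt_uniform F_uniform F_meet F_gt1.
case: (boolP [exists T : {set 'I_n},
    (#|T| == lambda) && [forall A in F, T \subset A]]).
  case/existsP=> T /andP[/eqP cardT /forall_inP sTF]; split; last by exists T.
  have starE : star F T = F.
    by apply/setP=> A; rewrite inE; apply/andb_idr/sTF.
  have <- : #|[set: 'I_n] :\: T| = n - lambda.
    by rewrite setTD cardsCs setCK cardT card_ord.
  rewrite -{1}starE; apply: card_star_hitting; first by rewrite cardT.
  move=> B; rewrite starE setIT => FB; rewrite setD_eq0; apply/negP.
  by move/subset_leq_card; rewrite F_uniform // cardT leqNgt lt_lk.
move=> no_core; apply: small.
have [A FA] : exists A, A \in F by apply/card_gt0P/ltnW.
apply: leq_trans (bin_square_lower_bound _); last by rewrite lambda_gt0.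
apply: card_no_sunflower (F_uniform) (F_meet) FA _ => T cardT.
rewrite leqNgt; apply: contra no_core => big_star.
apply/existsP; exists T; rewrite cardT eqxx; apply/forall_inP => B.
by apply: star_gt_sunflower F_uniform _ big_star; rewrite cardT.
Qed.
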